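(* Let $\Gamma>0$ and $\omega_p>0$. For real PID parameters $k_p,k_i,k_d$ consider the augmented system $\dot x=Ax+B_1w+B_2u$, $z=C_1x$ with $$A=\begin{bmatrix}0&1&0\\0&0&1\\-\Gamma k_i&-(\Gamma k_p+\omega_p^2)&-\Gamma k_d\end{bmatrix},\quad B_2=\begin{bmatrix}0\\0\\1\end{bmatrix},\quad B_1=\begin{bmatrix}0\\0\\-1\end{bmatrix},\quad C_1=\begin{bmatrix}\Gamma k_i&\Gamma k_p&\Gamma k_d\end{bmatrix}.$$ (i) If $k_d<0$, then $C_1B_2$ is nonsingular and $R=C_1B_1+B_1^TC_1^T>0$. (ii) The attainable degree of stability can be chosen arbitrarily by choice of the PID parameters: for every $\epsilon>0$ there exist $k_p,k_i\in\mathbb{R}$ and $k_d<0$ such that, with the state feedback $u=Kx$, $K=-(C_1B_2)^{-1}(C_1A+\epsilon C_1)$, the closed-loop system $\dot x=(A+B_2K)x+B_1w$, $z=C_1x$ is strictly negative imaginary with degree of stability $\epsilon$.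
   Context: The system is a realisation of the nominal plant $G_n(s)=\Gamma/(s^2+\omega_p^2)$ in series with the PID controller $C(s)=k_p+k_i/s+k_d s$, with input $e=u-(w+z)$ to $C(s)$ and output $z$ of $G_n(s)$. A square transfer function matrix $G(s)$ is strictly negative imaginary (SNI) if (1) $G(s)$ has no poles in $\operatorname{Re}[s]\ge 0$ and (2) $j\,(G(j\omega)-G(j\omega)^* )>0$ for all $\omega>0$, where $j=\sqrt{-1}$ and $^*$ is the conjugate transpose. The closed-loop system is SNI if $G_{cl}(s)=C_1(sI-A-B_2K)^{-1}B_1$ is SNI; it is SNI with degree of stability $\epsilon$ if in addition every eigenvalue $\lambda$ of $A+B_2K$ satisfies $\operatorname{Re}\lambda\le-\epsilon$. *)

(* Defs.v *)
From HB Require Import structures.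
From mathcomp Require Import all_boot all_order all_algebra.
From mathcomp Require Import complex.
From mathcomp Require Import reals.

Set Implicit Arguments.
Unset Strict Implicit.
Unset Printing Implicit Defensive.

Import Order.TTheory GRing.Theory Num.Theory.

Local Open Scope ring_scope.
Local Open Scope sesquilinear_scope.

Section RationalFunction.
Variable F : fieldType.
Implicit Types (f : {fraction {poly F}}) (a : F).

(* [repr f] is some pair (numerator, denominator) representing [f], not
   necessarily in lowest terms; dividing by the gcd cancels common factors. *)
Definition rf_gcd f : {poly F} := gcdp \n_(repr f) \d_(repr f).
Definition rf_num f : {poly F} := \n_(repr f) %/ rf_gcd f.
Definition rf_den f : {poly F} := \d_(repr f) %/ rf_gcd f.

Definition rf_pole f a : Prop := root (rf_den f) a.

(* Meaningful only when [a] is not a pole of [f]. *)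
Definition rf_eval f a : F := (rf_num f).[a] / (rf_den f).[a].

End RationalFunction.

Definition sym_posdef (R : realType) n (M : 'M[R]_n) : Prop :=
  M^T = M /\ forall x : 'cV[R]_n, x != 0 -> 0 < (x^T *m M *m x) 0 0.

Definition herm_posdef (R : realType) n (M : 'M[R[i]]_n) : Prop :=
  M^t* = M /\ forall x : 'cV[R[i]]_n, x != 0 -> 0 < (x^t* *m M *m x) 0 0.

Definition tf_pole (R : realType) m (G : 'M[{fraction {poly R[i]}}]_m)
    (s : R[i]) : Prop :=
  exists i j, rf_pole (G i j) s.

Definition tf_eval (R : realType) m (G : 'M[{fraction {poly R[i]}}]_m)
    (s : R[i]) : 'M[R[i]]_m :=
  \matrix_(i, j) rf_eval (G i j) s.

(* The imaginary unit j is ['i%C]. *)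
Definition SNI (R : realType) m (G : 'M[{fraction {poly R[i]}}]_m) : Prop :=
  (forall s : R[i], 0 <= complex.Re s -> ~ tf_pole G s) /\
  (forall w : R, 0 < w ->
     let Gjw := tf_eval G ('i%C * w%:C%C) in
     herm_posdef ('i%C *: (Gjw - Gjw^t*))).

(* A real matrix seen as a matrix of constant complex rational functions. *)
Definition rfmx (R : realType) m n (M : 'M[R]_(m, n)) :
    'M[{fraction {poly R[i]}}]_(m, n) :=
  map_mx (fun x : R => FracField.tofrac (x%:C%C)%:P) M.

(* C (s I - A)^-1 B, the inverse being taken over the field of rational
   functions in the indeterminate s = 'X; the characteristic polynomial of A is
   nonzero, so s I - A is always invertible there. *)
Definition transfer_function (R : realType) n m
    (A : 'M[R]_n) (B : 'M[R]_(n, m)) (C : 'M[R]_(m, n)) :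
    'M[{fraction {poly R[i]}}]_m :=
  rfmx C *m invmx ((FracField.tofrac 'X)%:M - rfmx A) *m rfmx B.

Definition SNI_with_degree (R : realType) n m
    (A : 'M[R]_n) (B : 'M[R]_(n, m)) (C : 'M[R]_(m, n)) (eps : R) : Prop :=
  SNI (transfer_function A B C) /\
  forall lambda : R[i],
    eigenvalue (map_mx (real_complex R) A) lambda ->
    complex.Re lambda <= - eps.

Definition mx_of_rows (R : realType) m n (rows : seq (seq R)) : 'M[R]_(m, n) :=
  \matrix_(i, j) (nth [::] rows i)`_j.

Section AugmentedSystem.
Variable R : realType.
Variables Gamma omega_p k_p k_i k_d : R.

Definition sysA : 'M[R]_3 := mx_of_rows 3 3
  [:: [:: 0; 1; 0];
      [:: 0; 0; 1];
      [:: - (Gamma * k_i); - (Gamma * k_p + omega_p ^+ 2); - (Gamma * k_d)]].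

Definition sysB1 : 'M[R]_(3, 1) := mx_of_rows 3 1 [:: [:: 0]; [:: 0]; [:: -1]].

Definition sysB2 : 'M[R]_(3, 1) := mx_of_rows 3 1 [:: [:: 0]; [:: 0]; [:: 1]].

Definition sysC1 : 'M[R]_(1, 3) := mx_of_rows 1 3
  [:: [:: Gamma * k_i; Gamma * k_p; Gamma * k_d]].

End AugmentedSystem.

Definition feedback_gain (R : realType) n m (A : 'M[R]_n) (B2 : 'M[R]_(n, m))
    (C1 : 'M[R]_(m, n)) (eps : R) : 'M[R]_(m, n) :=
  - (invmx (C1 *m B2) *m (C1 *m A + eps *: C1)).

(* Main.v *)
Require Import Defs.
From HB Require Import structures.
From mathcomp Require Import all_boot all_order all_algebra.
From mathcomp Require Import complex.
From mathcomp Require Import reals.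
From mathcomp Require Import ring lra.
From mathcomp Require Import generic_quotient.

Set Implicit Arguments.
Unset Strict Implicit.
Unset Printing Implicit Defensive.

Import Order.TTheory GRing.Theory Num.Theory.

Local Open Scope ring_scope.

(* Output-zeroing feedback makes the output matrix a left eigenvector:
   C1 (A + B2 K) = - eps C1. Hence C1 (s I - A - B2 K)^-1 B1 cancels down to the
   first-order lag C1 B1 / (s + eps), which is SNI as soon as C1 B1 > 0, i.e.
   k_d < 0. The closed loop is in companion form with characteristic polynomial
   (s + eps) (s^2 + (k_p / k_d) s + k_i / k_d); the choice k_d = -1,
   k_p = - 2 eps, k_i = - eps^2 turns it into (s + eps)^3. *)

(** * Poles and values of a rational function, read off any fraction for it *)

Lemma tofrac_numer (R : idomainType) (f : {fraction R}) :
  FracField.tofrac \n_(repr f) = f * FracField.tofrac \d_(repr f).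
Proof.
rewrite -[X in _ = X * _]reprK; move: (repr f) => x.
unlock FracField.tofrac; rewrite -[RHS]FracField.pi_mul.
apply/eqmodP; rewrite /= FracField.equivfE /FracField.mulf /=.
by rewrite !numden_Ratio ?mulr1 ?mul1r ?oner_neq0 ?denom_ratioP // mulrC.
Qed.

Lemma repr_fracE (R : idomainType) (p q : R) (f : {fraction R}) : q != 0 ->
  f = FracField.tofrac p / FracField.tofrac q ->
  \n_(repr f) * q = p * \d_(repr f).
Proof.
move=> q0 fE; apply/eqP; rewrite -tofrac_eq !tofracM tofrac_numer.
by rewrite {1}fE mulrAC divfK // tofrac_eq0.
Qed.

Section RationalFunctionTheory.
Variable F : fieldType.
Implicit Types (p q : {poly F}) (f : {fraction {poly F}}) (a : F).
Local Notation tofrac := (@FracField.tofrac {poly F}).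

Lemma rf_gcd_neq0 f : rf_gcd f != 0.
Proof. by rewrite gcdp_eq0 negb_and denom_ratioP orbT. Qed.

Lemma rf_numdenE p q f : q != 0 -> f = tofrac p / tofrac q ->
  rf_num f * q = p * rf_den f.
Proof.
move=> q0 /(repr_fracE q0) e; apply: (mulIf (rf_gcd_neq0 f)).
by rewrite mulrAC -[RHS]mulrA !divpK ?dvdp_gcdr ?dvdp_gcdl.
Qed.

(** The reduced numerator and denominator are coprime, so Gauss's lemma applies to
    [rf_num f * q = p * rf_den f]. Poles of [f] can thus be sought among the roots of any
    denominator. *)
Lemma rf_den_dvd p q f : q != 0 -> f = tofrac p / tofrac q -> rf_den f %| q.
Proof.
move=> q0 fE; have cop : coprimep (rf_den f) (rf_num f).
  rewrite coprimep_sym; apply: coprimep_div_gcd.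
  by rewrite denom_ratioP orbT.
by rewrite -(Gauss_dvdpr _ cop) (rf_numdenE q0 fE) dvdp_mulIr.
Qed.

Lemma rf_pole_frac p q f a :
  q != 0 -> f = tofrac p / tofrac q -> rf_pole f a -> root q a.
Proof.
move=> q0 fE; rewrite /rf_pole -!dvdp_XsubCl => /dvdp_trans-> //.
exact: rf_den_dvd fE.
Qed.

(** As [rf_den f] divides [q], it does not vanish at [a] either, and cross-multiplication compares
    the two quotients. *)
Lemma rf_eval_frac p q f a :
  q.[a] != 0 -> f = tofrac p / tofrac q -> rf_eval f a = p.[a] / q.[a].
Proof.
move=> qa0 fE; have q0 : q != 0 by apply: contraNneq qa0 => ->; rewrite horner0.
have da0 : (rf_den f).[a] != 0 by apply: contra qa0 => /(rf_pole_frac q0 fE).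
by apply/eqP; rewrite /rf_eval eqr_div // -!hornerM (rf_numdenE q0 fE).
Qed.

End RationalFunctionTheory.

(** * Transfer functions whose output matrix is a left eigenvector *)

Section LeftEigenvectorOutput.
Variable R : realType.

(** The gain is built so that [C1 B2 K = - (C1 A + eps C1)], which cancels [C1 A]. *)
Lemma feedback_gainP n m (A : 'M[R]_n) (B2 : 'M[R]_(n, m)) (C1 : 'M[R]_(m, n))
    (eps : R) : C1 *m B2 \in unitmx ->
  C1 *m (A + B2 *m feedback_gain A B2 C1 eps) = - eps *: C1.
Proof.
move=> u; rewrite /feedback_gain mulmxDr !mulmxN mulmxA mulKVmx //.
by rewrite opprD addrA subrr add0r scaleNr.
Qed.

Lemma rfmxE m n (M : 'M[R]_(m, n)) :
  rfmx M =
    map_mx (@FracField.tofrac _) (map_mx polyC (map_mx (real_complex R) M)).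
Proof. by apply/matrixP => i j; rewrite !mxE. Qed.

Lemma rfmxM m n p (M : 'M[R]_(m, n)) (N : 'M[R]_(n, p)) :
  rfmx (M *m N) = rfmx M *m rfmx N.
Proof. by rewrite !rfmxE !map_mxM. Qed.

Lemma rfmxZ m n (a : R) (M : 'M[R]_(m, n)) :
  rfmx (a *: M) = FracField.tofrac (a%:C%C)%:P *: rfmx M.
Proof. by rewrite !rfmxE !map_mxZ. Qed.

(** The matrix is the image of the characteristic matrix of [A], whose determinant is monic, hence
    nonzero. *)
Lemma resolvent_unitmx n (A : 'M[R]_n) :
  (FracField.tofrac 'X)%:M - rfmx A \in unitmx.
Proof.
have -> : (FracField.tofrac 'X)%:M - rfmx A =
    map_mx (@FracField.tofrac _) (char_poly_mx (map_mx (real_complex R) A)).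
  by rewrite /char_poly_mx map_mxB map_scalar_mx rfmxE.
rewrite unitmxE det_map_mx unitfE tofrac_eq0.
exact: monic_neq0 (char_poly_monic _).
Qed.

(** [C A = a C] gives [C (s I - A) = (s - a) C], hence [C (s I - A)^-1 = (s - a)^-1 C]. *)
Lemma transfer_function_left_eigen n m (A : 'M[R]_n) (B : 'M[R]_(n, m))
    (C : 'M[R]_(m, n)) (a : R) : C *m A = a *: C ->
  transfer_function A B C =
    (FracField.tofrac ('X - (a%:C%C)%:P))^-1 *: rfmx (C *m B).
Proof.
move=> CA; set q := FracField.tofrac _.
have q0 : q != 0 by rewrite tofrac_eq0 polyXsubC_eq0.
rewrite /transfer_function rfmxM; set S := _ - rfmx A.
have uS : S \in unitmx by exact: resolvent_unitmx.
have CS : rfmx C *m S = q *: rfmx C.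
  rewrite mulmxBr -rfmxM CA rfmxZ mul_mx_scalar -scalerBl.
  by rewrite /q tofracB.
rewrite scalemxAl; congr (_ *m _).
by rewrite -[RHS](mulmxK uS) -scalemxAl CS scalerA mulVf // scale1r.
Qed.

(** A positive element of [R[i]] is real, whence hermitian symmetry; the form is [|x|^2] times the
    entry. *)
Lemma herm_posdef_scalar1 (M : 'M[R[i]]_1) : 0 < M 0 0 -> herm_posdef M.
Proof.
move=> M0; split=> [|x x0].
  by apply/matrixP => i j; rewrite !ord1 !mxE; apply: CrealP; exact: gtr0_real.
rewrite !mxE big_ord1 !mxE big_ord1 !mxE.
have x00 : x 0 0 != 0.
  apply: contraNneq x0 => x00; apply/eqP/matrixP => i j.
  by rewrite !ord1 mxE.
by rewrite mulrAC mulrC mulr_gt0 // mulrC -normCK exprn_gt0 // normr_gt0.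
Qed.

Lemma imag_lag_gt0 (eps g w : R) (z : R[i]) : 0 < eps -> 0 < g -> 0 < w ->
  z = g%:C%C / ('i%C * w%:C%C + eps%:C%C) -> 0 < 'i%C * (z - Num.conj z).
Proof.
move=> e0 g0 w0 zE; set N := eps ^+ 2 + w ^+ 2.
have N0 : 0 < N by rewrite addr_gt0 // exprn_gt0.
(* Rationalising the denominator gives [z = g (eps - i w) / N]. *)
have {}zE : z = Complex (g * eps / N) (- (g * w / N)).
  rewrite zE; apply/(canLR (mulfK _)); last first.
    apply/eqP; rewrite eq_complex /=.
    by apply/andP; split; apply/eqP; rewrite /N; field; exact: lt0r_neq0.
  by rewrite eq_complex /= negb_and; simpc; rewrite (lt0r_neq0 e0).
have -> : Num.conj z = Complex (g * eps / N) (g * w / N).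
  by rewrite zE -[LHS]/(conjc _) /= opprK.
(* [i (z - conj z) = - 2 Im z], which is [2 g w / N]. *)
rewrite zE ltcE /=; simpc.
by rewrite addr_gt0 // divr_gt0 // mulr_gt0.
Qed.

Lemma SNI_left_eigen n (A : 'M[R]_n) (B : 'M[R]_(n, 1)) (C : 'M[R]_(1, n))
    (eps : R) : 0 < eps -> C *m A = - eps *: C -> 0 < (C *m B) 0 0 ->
  SNI (transfer_function A B C).
Proof.
move=> eps0 CA CB0; rewrite (transfer_function_left_eigen B CA).
set q := 'X - _; set G := _ *: _.
have q0 : q != 0 by rewrite polyXsubC_eq0.
have GE i j : G i j =
    FracField.tofrac (((C *m B) 0 0)%:C%C)%:P / FracField.tofrac q.
  by rewrite !ord1 /G !mxE mulrC.
have qE s : q.[s] = s + eps%:C%C by rewrite hornerXsubC rmorphN opprK.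
split=> [[x y] /= x0 [i [j]]|w w0 /=].
  (* The only candidate pole is [- eps], where the real part would satisfy [x + eps = 0]. *)
  move=> /(rf_pole_frac q0 (GE i j)); rewrite /root qE eq_complex /= => /andP[].
  by rewrite gt_eqF // ltr_wpDl.
have tfE : tf_eval G ('i%C * w%:C%C) 0 0 =
    ((C *m B) 0 0)%:C%C / ('i%C * w%:C%C + eps%:C%C).
  rewrite mxE (rf_eval_frac _ (GE _ _)) qE ?hornerC //.
  by rewrite eq_complex /= negb_and; simpc; rewrite (lt0r_neq0 eps0).
(* Abstracting the evaluated matrix keeps [mxE] from unfolding it. *)
apply: herm_posdef_scalar1; move: (tf_eval _ _) tfE => T tfE.
by rewrite !mxE; exact: imag_lag_gt0 tfE.
Qed.

End LeftEigenvectorOutput.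

(** * The augmented PID system and its closed-loop spectrum *)

Section AugmentedSystemTheory.
Variable R : realType.
Variables Gamma omega_p k_p k_i k_d : R.
Hypothesis Gamma_gt0 : 0 < Gamma.
Local Notation A := (sysA Gamma omega_p k_p k_i k_d).
Local Notation B1 := (sysB1 R).
Local Notation B2 := (sysB2 R).
Local Notation C1 := (sysC1 Gamma k_p k_i k_d).

Lemma sysC1B1E : (C1 *m B1) 0 0 = - (Gamma * k_d).
Proof. by rewrite !mxE !big_ord_recl big_ord0 !mxE /=; ring. Qed.

Lemma sysC1B2E : (C1 *m B2) 0 0 = Gamma * k_d.
Proof. by rewrite !mxE !big_ord_recl big_ord0 !mxE /=; ring. Qed.

Lemma sysC1B2_unitmx : k_d < 0 -> C1 *m B2 \in unitmx.
Proof.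
move=> kd0; rewrite unitmxE det_mx11 sysC1B2E unitfE.
by rewrite mulf_neq0 ?(ltr0_neq0 kd0) ?lt0r_neq0.
Qed.

Lemma sym_posdef_sysC1B1 :
  k_d < 0 -> sym_posdef (C1 *m B1 + B1^T *m C1^T).
Proof.
move=> kd0; rewrite -trmx_mul; split=> [|x x0].
  by rewrite linearD /= trmxK addrC.
have x00 : x 0 0 != 0.
  apply: contraNneq x0 => x00; apply/eqP/matrixP => i j.
  by rewrite !ord1 mxE.
have : 0 < (C1 *m B1 + (C1 *m B1)^T) 0 0.
  by rewrite mxE [_^T _ _]mxE sysC1B1E -mulrN addr_gt0 // mulr_gt0 // oppr_gt0.
move: (_ + _) => M M0; rewrite !mxE big_ord1 !mxE big_ord1 !mxE.
by rewrite mulrAC mulr_gt0 // -expr2 exprn_even_gt0.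
Qed.

(** Only the last row of [B2 K] can be nonzero, so feedback preserves the companion form. *)
Lemma sysA_feedback_rowE (K : 'M[R]_(1, 3)) (j : 'I_3) :
  ((A + B2 *m K) 0 j = (j == 1 :> nat)%:R) *
  ((A + B2 *m K) 1 j = (j == 2 :> nat)%:R).
Proof.
by split; rewrite !mxE big_ord1 !mxE /= mul0r addr0; case: j => -[|[|[|//]]].
Qed.

(** The left-hand side is [k_d] times the characteristic polynomial of the closed loop at [lambda];
    the left-eigenvector relation for [C1] supplies the last row of the matrix, scaled by [k_d]. *)
Lemma closed_loop_eigenvalue (eps : R) (K : 'M[R]_(1, 3)) (lambda : R[i]) :
  C1 *m (A + B2 *m K) = - eps *: C1 ->
  eigenvalue (map_mx (real_complex R) (A + B2 *m K)) lambda ->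
  (lambda + eps%:C%C) *
    (k_d%:C%C * lambda ^+ 2 + k_p%:C%C * lambda + k_i%:C%C) = 0.
Proof.
set M := A + B2 *m K => CM /eigenvalueP[v vM v0].
have M0 j : M 0 j = (j == 1 :> nat)%:R by rewrite sysA_feedback_rowE.
have M1 j : M 1 j = (j == 2 :> nat)%:R by rewrite sysA_feedback_rowE.
clearbody M.
have ordE : (lift ord0 ord0 = 1 :> 'I_3) *
    (lift ord0 (lift ord0 ord0) = 2 :> 'I_3).
  by split; apply: val_inj.
(* Entry [j] of [CM], with the common factor [Gamma] cancelled. *)
have C1M j : k_i * M 0 j + k_p * M 1 j + k_d * M 2 j =
    - eps * [:: k_i; k_p; k_d]`_j.
  have /matrixP/(_ 0 j) := CM; rewrite !mxE !big_ord_recl big_ord0 !ordE.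
  rewrite ![sysC1 _ _ _ _ _ _]mxE /= => e.
  apply: (mulfI (lt0r_neq0 Gamma_gt0)); move: e.
  move: (M 0 j) (M 1 j) (M 2 j) => m0 m1 m2.
  by case: (nat_of_ord j) (ltn_ord j) => [|[|[|//]]] _ /=; lra.
have vME j : v 0 0 * (M 0 j)%:C%C + v 0 1 * (M 1 j)%:C%C + v 0 2 * (M 2 j)%:C%C
    = lambda * v 0 j.
  have /matrixP/(_ 0 j) := vM; rewrite !mxE !big_ord_recl big_ord0 !ordE.
  by rewrite ![map_mx _ _ _ _]mxE addr0 addrA.
have e0 := vME 0; have e1 := vME 1; have e2 := vME 2.
have c0 := congr1 (real_complex R) (C1M 0).
have c1 := congr1 (real_complex R) (C1M 1).
have c2 := congr1 (real_complex R) (C1M 2).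
rewrite !M0 !M1 /= !(rmorph0, rmorph1) in e0 e1 e2 c0 c1 c2.
rewrite !(rmorphD, rmorphM, rmorphN, rmorph0, rmorph1) /= in c0 c1 c2.
rewrite !(mulr0, mulr1, add0r, addr0) in e0 e1 e2 c0 c1 c2.
have v1E : v 0 1 = (lambda - (M 2 2)%:C%C) * v 0 2 by rewrite mulrBl -e2; ring.
have v0E : v 0 0 = lambda * v 0 1 - (M 2 1)%:C%C * v 0 2 by rewrite -e1; ring.
(* In companion form the last entry of a left eigenvector determines the other two, so it cannot
   vanish. *)
have v20 : v 0 2 != 0.
  apply: contraNneq v0 => v20.
  have v10 : v 0 1 = 0 by rewrite v1E v20 mulr0.
  have v00 : v 0 0 = 0 by rewrite v0E v10 v20 !mulr0 subr0.
  apply/eqP/rowP => j; rewrite mxE.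
  case: j => -[|[|[|//]]] jP.
  - by rewrite -[RHS]v00; congr (v _ _); apply: val_inj.
  - by rewrite -[RHS]v10; congr (v _ _); apply: val_inj.
  - by rewrite -[RHS]v20; congr (v _ _); apply: val_inj.
apply: (mulIf v20); rewrite mul0r.
(* The column equation [e0] is the one not yet used. The factor [k_d] lets [c0], [c1], [c2] replace
   the last-row entries without division. *)
transitivity (k_d%:C%C * (lambda * v 0 0 - v 0 2 * (M 2 0)%:C%C)); last first.
  by rewrite -e0 subrr mulr0.
rewrite v0E v1E.
transitivity ((k_d%:C%C * lambda ^+ 3 - k_d%:C%C * (M 2 2)%:C%C * lambda ^+ 2 -
  k_d%:C%C * (M 2 1)%:C%C * lambda - k_d%:C%C * (M 2 0)%:C%C) * v 0 2);
  last by ring.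
have {}c1 : k_d%:C%C * (M 2 1)%:C%C = - eps%:C%C * k_p%:C%C - k_i%:C%C.
  by rewrite -c1 addrAC subrr add0r.
have {}c2 : k_d%:C%C * (M 2 2)%:C%C = - eps%:C%C * k_d%:C%C - k_p%:C%C.
  by rewrite -c2 addrAC subrr add0r.
by rewrite c0 c1 c2; ring.
Qed.

End AugmentedSystemTheory.

Theorem mainTheorem3 (R : realType) (Gamma omega_p : R)
    (Gamma_gt0 : 0 < Gamma) (omega_p_gt0 : 0 < omega_p) :
  (forall k_p k_i k_d : R, k_d < 0 ->
     let B1 := sysB1 R in
     let B2 := sysB2 R in
     let C1 := sysC1 Gamma k_p k_i k_d in
     C1 *m B2 \in unitmx /\ sym_posdef (C1 *m B1 + B1^T *m C1^T)) /\
  (forall eps : R, 0 < eps ->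
     exists k_p k_i k_d : R, k_d < 0 /\
       let A := sysA Gamma omega_p k_p k_i k_d in
       let B1 := sysB1 R in
       let B2 := sysB2 R in
       let C1 := sysC1 Gamma k_p k_i k_d in
       let K := feedback_gain A B2 C1 eps in
       SNI_with_degree (A + B2 *m K) B1 C1 eps).
Proof.
split=> [k_p k_i k_d kd0|eps eps0].
  by split; [exact: sysC1B2_unitmx | exact: sym_posdef_sysC1B1].
exists (- (2 * eps)), (- eps ^+ 2), (-1).
have kd0 : -1 < 0 :> R by rewrite oppr_lt0.
split=> // A B1 B2 C1 K.
have u : C1 *m B2 \in unitmx by exact: sysC1B2_unitmx.
have CA := feedback_gainP A eps u.
split.
  apply: SNI_left_eigen eps0 CA _.
  by rewrite sysC1B1E mulrN1 opprK.
move=> lambda /(closed_loop_eigenvalue Gamma_gt0 CA) e.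
have : (lambda + eps%:C%C) ^+ 3 = 0.
  (* Since [k_d = -1], the product in [e] is [- (lambda + eps)^3], hence the change of sign. *)
  rewrite -[RHS]oppr0 -[in RHS]e.
  by rewrite !(rmorphN, rmorphM, rmorph1, rmorph_nat, rmorphXn) /=; ring.
by move=> /eqP; rewrite expf_eq0 /= addr_eq0 => /eqP ->; rewrite -rmorphN.
Qed.
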